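(* Let $v_1,\dots,v_k\in\mathbb{Z}_{\ge0}^2$, none lying on a coordinate axis, be such that $\mathcal U=U((1,0),(0,1),v_1,\dots,v_k)$ is non-degenerate. Then there exists $v=(w_1,w_2)\in\mathbb{Z}_{\ge0}^2$ such that every $(m,n)\in\mathcal U$ with $m\ge w_1$ and $n\ge w_2$ satisfies $m\equiv w_1\pmod 2$ and $n\equiv w_2\pmod 2$.
   Context: Fix a norm on $\mathbb{Z}^2$ increasing monotonically in each coordinate. For vectors $u_1,\dots,u_r\in\mathbb{Z}_{\ge0}^2$, the Ulam set $U(u_1,\dots,u_r)$ is built recursively: it starts with $u_1,\dots,u_r$, and at each step one adds a vector not yet in the set, of smallest norm among those that can be written as a sum of two distinct vectors of the current set in exactly one way (the resulting set is known not to depend on the choice of such norm or on tie-breaking). $U(u_1,\dots,u_r)$ is non-degenerate if $u_i\notin U(u_1,\dots,u_{i-1},u_{i+1},\dots,u_r)$ for each $i$. *)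

(* Defs.v *)
From mathcomp Require Import all_boot all_order all_algebra.
From mathcomp Require Import boolp classical_sets reals.

Set Implicit Arguments.
Unset Strict Implicit.
Unset Printing Implicit Defensive.

Import Order.TTheory GRing.Theory Num.Theory.
Local Open Scope classical_set_scope.
Local Open Scope ring_scope.

(* Z_{>=0}^2, with the componentwise addition of the pair nmodType *)
Definition vec : Type := (nat * nat)%type.

Definition vec_int (x : vec) : int * int := (x.1%:Z, x.2%:Z).

(* Monotonicity is required on the quadrant only (a norm is even, so it cannot
   be monotone on all of Z^2), and it is strict: for a merely nondecreasing
   norm, such as the sup norm, the Ulam set depends on how ties are broken. *)
Record monotone_norm (R : realType) (N : int * int -> R) : Prop := MonotoneNorm {
  mnorm_eq0 : forall x : int * int, N x = 0 -> x = 0;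
  mnormD : forall x y : int * int, N (x + y) <= N x + N y;
  mnormZ : forall (x : int * int) (a : int), N (x *~ a) = `|a|%:~R * N x;
  mnorm_lt1 : forall m m' n : nat, (m < m')%N ->
    N (m%:Z, n%:Z) < N (m'%:Z, n%:Z);
  mnorm_lt2 : forall m n n' : nat, (n < n')%N ->
    N (m%:Z, n%:Z) < N (m%:Z, n'%:Z)
}.

(* A representation is an unordered pair of distinct elements of S. *)
Definition unique_sum (S : set vec) (w : vec) : Prop :=
  exists a b : vec, [/\ S a, S b, a <> b, a + b = w &
    forall c d : vec, S c -> S d -> c <> d -> c + d = w ->
      (c = a /\ d = b) \/ (c = b /\ d = a)].

Definition ulam_candidate (S : set vec) (w : vec) : Prop :=
  ~ S w /\ unique_sum S w.

(* The second alternative is a construction that has stopped, as for a single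
   starting vector. *)
Definition ulam_step (R : realType) (N : int * int -> R) (S S' : set vec) : Prop :=
  (exists w : vec,
     [/\ ulam_candidate S w,
         forall w' : vec, ulam_candidate S w' -> N (vec_int w) <= N (vec_int w') &
         S' = w |` S])
  \/ ((forall w : vec, ~ ulam_candidate S w) /\ S' = S).

(* U is the set produced by some run of the construction, ties being broken
   arbitrarily. Such a U always exists; for a monotone norm and nonzero
   starting vectors it is unique and does not depend on the norm. *)
Definition is_ulam_set (R : realType) (N : int * int -> R)
    (us : seq vec) (U : set vec) : Prop :=
  exists S : nat -> set vec,
    [/\ S 0%N = [set` us],
        forall n : nat, ulam_step N (S n) (S n.+1) &
        U = \bigcup_n S n].

(* The starting vectors are a list: a repeated vector is degenerate. *)
Definition ulam_nondegenerate (R : realType) (N : int * int -> R) (us : seq vec) : Prop :=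
  forall i : nat, (i < size us)%N ->
    forall U : set vec, is_ulam_set N (take i us ++ drop i.+1 us) U ->
      ~ U (nth (0, 0)%N us i).

(* Main.v *)
(* The Ulam set is characterised by: v is in U iff v is a starting vector or has
   exactly one representation in U, because summands have smaller norm.  Hence
   row 1 and column 1 are full, so (m, n) = (1, n-1) + (m-1, 1) is always a
   representation, and any point of row n-1 (column m-1) weakly to the left of
   (below) a non-starting (m, n), apart from column 1 (row 1), would give a
   second one.
   Take the least unbounded column m0.  Column m0 - 1 is then empty, the columns
   before it are bounded by some W, and so for n > 2W a point (m0, n) is in U
   iff (m0, n-1) is not: column m0 alternates.  A point (m, n) of U with
   m >= m0 forces row n-1 to miss column m0, hence (m0, n) is in U and n has
   the parity of column m0.  Exchanging the coordinates handles m. *)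
Require Import Defs.
From mathcomp Require Import all_boot all_order all_algebra.
From mathcomp Require Import boolp classical_sets reals.
From mathcomp Require Import zify.

Set Implicit Arguments.
Unset Strict Implicit.
Unset Printing Implicit Defensive.

Import Order.TTheory GRing.Theory Num.Theory.
Local Open Scope classical_set_scope.

(** * Unique sums, and a norm-free form of the Ulam property *)

Lemma unique_sum_rep (S : set vec) (w a b c d : vec) :
  unique_sum S w -> S a -> S b -> a <> b -> (a + b)%R = w ->
  S c -> S d -> c <> d -> (c + d)%R = w -> c = a \/ c = b.
Proof.
case=> [e [f [_ _ _ _ uef]]] Sa Sb ab abw Sc Sd cd cdw.
case: (uef a b Sa Sb ab abw) => [[-> ->]|[-> ->]];
  case: (uef c d Sc Sd cd cdw) => [[-> _]|[-> _]]; auto.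
Qed.

Definition transpose (S : set vec) : set vec := fun v => S (v.2, v.1).

Lemma transposeK (S : set vec) : transpose (transpose S) = S.
Proof. by apply: funext => -[]. Qed.

Lemma unique_sum_transpose (S : set vec) (v : vec) :
  unique_sum (transpose S) v <-> unique_sum S (v.2, v.1).
Proof.
suff H (T : set vec) w : unique_sum T (w.2, w.1) -> unique_sum (transpose T) w.
  split=> [uv|]; last exact: H.
  by rewrite -(transposeK S); apply: (H _ (v.2, v.1)); case: v uv.
case: w => w1 w2 [[a1 a2] [[b1 b2] [Sa Sb ab [ab1 ab2] uab]]].
exists (a2, a1), (b2, b1); split=> //.
- by case=> ba1 ba2; apply: ab; rewrite ba1 ba2.
- by congr pair.
- move=> [c1 c2] [d1 d2] Sc Sd cd [cd1 cd2].
  have := uab (c2, c1) (d2, d1) Sc Sd.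
  case=> [|||].
  + by case=> dc1 dc2; apply: cd; rewrite dc1 dc2.
  + by congr pair.
  + by case=> [[-> ->] [-> ->]]; left.
  + by case=> [[-> ->] [-> ->]]; right.
Qed.

(** All that the parity argument uses about an Ulam set. No norm occurs and the conditions are
    symmetric in the coordinates, so facts on rows transfer to columns; [M] confines the starting
    vectors [I] to a box. *)
Record ulam_closed (M : nat) (I U : set vec) : Prop := UlamClosed {
  bound_gt1 : 1 < M;
  start_e1 : I (1, 0);
  start_e2 : I (0, 1);
  start_axis1 : forall n, I (0, n) -> n = 1;
  start_axis2 : forall m, I (m, 0) -> m = 1;
  start_bounded : forall m n, I (m, n) -> m <= M /\ n <= M;
  ulam_closedE : forall v, U v <-> I v \/ unique_sum U v
}.

Lemma ulam_closed_transpose (M : nat) (I U : set vec) :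
  ulam_closed M I U -> ulam_closed M (transpose I) (transpose U).
Proof.
case=> M1 I1 I2 Ia1 Ia2 Ib UE; split=> //.
- by move=> m n /Ib [].
- by move=> v; rewrite unique_sum_transpose; exact: UE.
Qed.

(** * Rows and columns near the axes; neighbouring rows and columns *)

(** Summands of an axis point lie on the axis and are nonzero, so by induction both would be
    [(1, 0)], against distinctness. *)
Lemma ulam_row0 {M : nat} {I U : set vec} (UP : ulam_closed M I U) (m : nat) :
  U (m, 0) -> m = 1.
Proof.
elim/ltn_ind: m => m IHm /(ulam_closedE UP) [/(start_axis2 UP)//|].
case=> [[a1 a2] [[b1 b2] [Ua Ub ab [E1 E2] _]]].
have U0 : ~ U (0, 0).
  case/(ulam_closedE UP) => [/(start_axis2 UP)//|].
  case=> [[c1 c2] [[d1 d2] [_ _ cd [F1 F2] _]]]; apply: cd.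
  have [-> [-> [-> ->]]] // : c1 = 0 /\ c2 = 0 /\ d1 = 0 /\ d2 = 0.
  rewrite /GRing.add /= in F1 F2; lia.
rewrite /GRing.add /= in E1 E2.
have [a20 b20] : a2 = 0 /\ b2 = 0 by lia.
move: Ua Ub ab; rewrite {}a20 {}b20 => Ua Ub ab.
have a0 : a1 <> 0 by move=> a0; apply: U0; rewrite -{1}a0.
have b0 : b1 <> 0 by move=> b0; apply: U0; rewrite -{1}b0.
have a1E : a1 = 1 by apply: IHm => //; lia.
have b1E : b1 = 1 by apply: IHm => //; lia.
by case: ab; rewrite a1E b1E.
Qed.

(** One summand of [(m.+1, 1)] lies in row 0, so it is [(1, 0)] and the other is determined. *)
Lemma ulam_row1 {M : nat} {I U : set vec} (UP : ulam_closed M I U) (m : nat) : U (m, 1).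
Proof.
elim: m => [|m IHm]; first by apply/(ulam_closedE UP); left; exact: start_e2 UP.
apply/(ulam_closedE UP); right; exists (1, 0), (m, 1); split=> //.
  by apply/(ulam_closedE UP); left; exact: start_e1 UP.
move=> [c1 c2] [d1 d2] Uc Ud cd []; rewrite /GRing.add /= => E1 E2.
have [c20|d20] : c2 = 0 \/ d2 = 0 by lia.
- left; move: Uc; rewrite c20 => /(ulam_row0 UP) c11.
  by split; congr pair; lia.
- right; move: Ud; rewrite d20 => /(ulam_row0 UP) d11.
  by split; congr pair; lia.
Qed.


Lemma ulam_unique {M : nat} {I U : set vec} (UP : ulam_closed M I U) (m n : nat) :
  M < m \/ M < n -> U (m, n) <-> unique_sum U (m, n).
Proof.
move=> Mmn; rewrite (ulam_closedE UP); split=> [[/(start_bounded UP)|//]|]; last by right.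
by case=> mM nM; lia.
Qed.

Lemma ulam_col0 {M : nat} {I U : set vec} (UP : ulam_closed M I U) (n : nat) :
  U (0, n) -> n = 1.
Proof. exact: ulam_row0 (ulam_closed_transpose UP) n. Qed.

Lemma ulam_col1 {M : nat} {I U : set vec} (UP : ulam_closed M I U) (n : nat) : U (1, n).
Proof. exact: ulam_row1 (ulam_closed_transpose UP) n. Qed.

(* (m, n) = (1, n - 1) + (m - 1, 1) leaves room for no other representation. *)
Lemma ulam_prev_row_empty {M : nat} {I U : set vec} (UP : ulam_closed M I U) (m n x : nat) :
  M < n -> U (m, n) -> 1 < x <= m -> ~ U (x, n.-1).
Proof.
move=> Mn Umn xm Ux; have M1 := bound_gt1 UP.
have uS := (ulam_unique UP (or_intror Mn)).1 Umn.
case: (@unique_sum_rep U (m, n) (1, n.-1) (m.-1, 1) (x, n.-1) (m - x, 1) uS) => //.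
- exact: ulam_col1 UP _.
- exact: ulam_row1 UP _.
- by case=> _; lia.
- by congr pair; rewrite /GRing.add /=; lia.
- exact: ulam_row1 UP _.
- by case=> _; lia.
- by congr pair; rewrite /GRing.add /=; lia.
- by case; lia.
- by case=> _; lia.
Qed.

(** [(m.-1, y) + (1, n - y)] would be a second representation besides [(m.-1, 1) + (1, n.-1)].
    Transposing [ulam_prev_row_empty] would require [M < m], while here only [n] is large. *)
Lemma ulam_prev_col_empty {M : nat} {I U : set vec} (UP : ulam_closed M I U) (m n y : nat) :
  2 < m -> M < n -> U (m, n) -> 1 < y <= n -> ~ U (m.-1, y).
Proof.
move=> m2 Mn Umn yn Uy; have M1 := bound_gt1 UP.
have uS := (ulam_unique UP (or_intror Mn)).1 Umn.
case: (@unique_sum_rep U (m, n) (1, n.-1) (m.-1, 1) (m.-1, y) (1, n - y) uS) => //.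
- exact: ulam_col1 UP _.
- exact: ulam_row1 UP _.
- by case=> _; lia.
- by congr pair; rewrite /GRing.add /=; lia.
- exact: ulam_col1 UP _.
- by case=> ? _; lia.
- by congr pair; rewrite /GRing.add /=; lia.
- by case=> ? _; lia.
- by case; lia.
Qed.

(** Column 1 alone gives two representations, [(1, n.-1) + (1, 1)] and [(1, n) + (1, 0)]. *)
Lemma ulam_col2 {M : nat} {I U : set vec} (UP : ulam_closed M I U) (n : nat) :
  M < n -> ~ U (2, n).
Proof.
move=> Mn U2; have M1 := bound_gt1 UP.
have uS := (ulam_unique UP (or_intror Mn)).1 U2.
case: (@unique_sum_rep U (2, n) (1, n.-1) (1, 1) (1, n) (1, 0) uS) => //.
- exact: ulam_col1 UP _.
- exact: ulam_col1 UP _.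
- by case; lia.
- by congr pair; rewrite /GRing.add /=; lia.
- exact: ulam_col1 UP _.
- exact: ulam_col1 UP _.
- by case; lia.
- by congr pair; rewrite /GRing.add /=; lia.
- by case; lia.
- by case; lia.
Qed.

(** Let [c1] be the smaller first coordinate in a representation of [(m, n)]. If [c1 = 0], that
    summand is [(0, 1)] and [(m, n.-1)] would be in [U]; if [c1 = 1], the other summand is in column
    [m.-1], where only height 1 is possible; if [c1 > 1], both heights are at most [W], too small
    for [n]. *)
Lemma ulam_col_step {M : nat} {I U : set vec} (UP : ulam_closed M I U)
    (m n W : nat) :
  2 < m -> M <= W -> W.*2 < n ->
  (forall x y, 1 < x < m -> U (x, y) -> y <= W) ->
  (forall y, 1 < y -> ~ U (m.-1, y)) ->
  ~ U (m, n.-1) -> U (m, n).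
Proof.
move=> m2 MW Wn colW colm Umn1; have M1 := bound_gt1 UP.
apply/(ulam_unique UP); first by right; lia.
exists (1, n.-1), (m.-1, 1); split=> //.
- exact: ulam_col1 UP _.
- exact: ulam_row1 UP _.
- by case=> _; lia.
- by congr pair; rewrite /GRing.add /=; lia.
suff main c1 c2 d1 d2 : U (c1, c2) -> U (d1, d2) -> c1 + d1 = m -> c2 + d2 = n ->
    c1 <= d1 -> (c1, c2) = (1, n.-1) /\ (d1, d2) = (m.-1, 1).
  move=> [c1 c2] [d1 d2] Uc Ud _ []; rewrite /GRing.add /= => E1 E2.
  case: (leqP c1 d1) => cd; first by left; apply: main.
  by right; case: (main _ _ _ _ Ud Uc _ _ (ltnW cd)) => //; lia.
move=> Uc Ud E1 E2 cd.
have [c10|[c11|c12]] : c1 = 0 \/ c1 = 1 \/ 1 < c1 by lia.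
- move: Uc; rewrite c10 => /(ulam_col0 UP) c21; case: Umn1.
  by rewrite (_ : (m, n.-1) = (d1, d2)) //; congr pair; lia.
- have d1E : d1 = m.-1 by lia.
  have d2le : d2 <= 1.
    by rewrite leqNgt; apply/negP => /colm; rewrite -d1E; apply.
  have d20 : d2 <> 0 by move=> d20; move: Ud; rewrite d20 => /(ulam_row0 UP); lia.
  by split; congr pair; lia.
- by have := colW _ _ _ Uc; have := colW _ _ _ Ud; lia.
Qed.

(** * Bounded and unbounded columns, and parity *)

Definition col_bounded (U : set vec) (x W : nat) : Prop := forall y, U (x, y) -> y <= W.

Lemma col_bounded_upto (M : nat) (U : set vec) (m : nat) :
  (forall x, 1 < x < m -> exists W, col_bounded U x W) ->
  exists W, M <= W /\ forall x, 1 < x < m -> col_bounded U x W.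
Proof.
elim: m => [_|m IHm bm]; first by exists M; split=> // x; lia.
have [x xm|W [MW bW]] := IHm; first by apply: bm; lia.
have [m1|m1] := leqP m 1; first by exists W; split=> // x; lia.
have [|V bV] := bm m; first by lia.
exists (W + V); split; first by lia.
move=> x xm y Uxy; have [xE|xNm] := eqVneq x m.
  by move: Uxy; rewrite xE => /bV; lia.
by have := bW x _ y Uxy; lia.
Qed.

(* The lowest points of consecutive nonempty columns descend. *)
Lemma exists_empty_col {M : nat} {I U : set vec} (UP : ulam_closed M I U) :
  exists2 x, M < x & forall y, 1 < y -> ~ U (x, y).
Proof.
suff main : forall y x, M < x -> 1 < y -> U (x, y) ->
    exists2 x, M < x & forall y, 1 < y -> ~ U (x, y).
  have [H|H] := pselect (exists2 y, 1 < y & U (M.+1, y)).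
    by case: H => y y1; apply: main.
  by exists M.+1 => // y y1 Uy; apply: H; exists y.
elim/ltn_ind => y IHy x Mx y1 Uxy.
have [H|H] := pselect (exists2 z, 1 < z & U (x.+1, z)); last first.
  by exists x.+1; [lia|move=> z z1 Uz; apply: H; exists z].
case: H => z z1 Uz; have [yz|zy] := leqP y z; last by apply: (IHy z zy x.+1) => //; lia.
have Mx1 : M < x.+1 by lia.
by case: (@ulam_prev_row_empty M _ _ (ulam_closed_transpose UP) z x.+1 y Mx1 Uz _ Uxy); lia.
Qed.


(** Were all columns past the first bounded, [ulam_col_step] just right of an empty column would
    give a point above the bound. *)
Lemma exists_unbounded_col {M : nat} {I U : set vec} (UP : ulam_closed M I U) :
  exists2 m, 1 < m & forall W, ~ col_bounded U m W.
Proof.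
apply: contrapT => noc; have M1 := bound_gt1 UP.
have bd x : 1 < x -> exists W, col_bounded U x W.
  move=> x1; apply: contrapT => nW; apply: noc; exists x => // W bW.
  by apply: nW; exists W.
have [m Mm colm] := exists_empty_col UP.
(* [m.+2] puts column [m.+1] itself under the bound, so [(m.+1, W.*2)] is missing, as
   [ulam_col_step] requires. *)
have [|W [MW bW]] := @col_bounded_upto M U m.+2; first by move=> x /andP[/bd].
suff /(bW m.+1) : U (m.+1, W.*2.+1) by lia.
apply: (ulam_col_step UP (W := W)) => //; try lia.
  by move=> x y xm; apply: bW; lia.
by move=> /(bW m.+1); lia.
Qed.

Lemma ulam_row_parity {M : nat} {I U : set vec} (UP : ulam_closed M I U) :
  exists m0 n0, forall m n, U (m, n) -> m0 <= m -> n0 <= n -> n = n0 %[mod 2].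
Proof.
have M1 := bound_gt1 UP.
have exm : exists m, `[< 1 < m /\ forall W, ~ col_bounded U m W >].
  by have [m m1 mW] := exists_unbounded_col UP; exists m; apply/asboolP.
case: (ex_minnP exm) => m0 /asboolP [m01 unb] minm0.
have [x xm|W [MW bW]] := @col_bounded_upto M U m0.
  apply: contrapT => nW; suff: m0 <= x by lia.
  by apply: minm0; apply/asboolP; split=> [|W bW]; [lia|apply: nW; exists W].
have m02 : 2 < m0.
  rewrite ltn_neqAle m01 andbT; apply/eqP => m02; apply: (unb M) => y.
  by rewrite -m02 leqNgt => Uy; apply/negP => /(ulam_col2 UP).
(* A single such point would bound column [m0] by [M + y]. *)
have empty y : 1 < y -> ~ U (m0.-1, y).
  move=> y1 Uy; apply: (unb (M + y)) => n Un; rewrite leqNgt; apply/negP => nMy.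
  by apply: (ulam_prev_col_empty UP m02 _ Un _ Uy) => //; lia.
have up n : W.*2 < n -> ~ U (m0, n.-1) -> U (m0, n).
  by move=> Wn; apply: (ulam_col_step UP m02 MW) => // x y xm; apply: bW.
have down n : W.*2 < n -> U (m0, n) -> ~ U (m0, n.-1).
  by move=> Wn Un; apply: (ulam_prev_row_empty UP _ Un); lia.
(* One of the first two heights above [W.*2] occurs in column [m0]. *)
have [n0 Wn0 Un0] : exists2 n0, W.*2 < n0 & U (m0, n0).
  have [U1|U1] := pselect (U (m0, W.*2.+1)); first by exists W.*2.+1.
  by exists W.*2.+2; [lia|apply: up => //; lia].
have alt k : U (m0, n0 + k) <-> ~~ odd k.
  elim: k => [|k IHk]; first by rewrite addn0.
  rewrite addnS /= negbK; split=> [Uk|ok].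
    apply: contrapT => /negP /IHk; apply: (down (n0 + k).+1) => //; lia.
  by apply: up; [lia|move=> /IHk; rewrite ok].
exists m0, n0 => m n Umn m0m n0n.
have Un : U (m0, n).
  by apply: up; [lia|apply: (ulam_prev_row_empty UP _ Umn); lia].
have nE : n = n0 + (n - n0) by lia.
by move: Un; rewrite nE => /alt; lia.
Qed.

(** * Subsets, sums and monotone norms *)

Lemma unique_sum_subset (S T : set vec) (w a b : vec) :
  S `<=` T -> S a -> S b -> a <> b -> (a + b)%R = w ->
  unique_sum T w -> unique_sum S w.
Proof.
move=> sST Sa Sb ab abw [c [d [Tc Td cd cdw ucd]]].
exists a, b; split=> // e f Se Sf ef efw.
have := ucd e f (sST _ Se) (sST _ Sf) ef efw.
by case: (ucd a b (sST _ Sa) (sST _ Sb) ab abw) => [[-> ->]|[-> ->]]; tauto.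
Qed.

Lemma vec_sum0 (a b : vec) : (a + b)%R = (0, 0) -> a = b.
Proof.
case: a b => [a1 a2] [b1 b2] []; rewrite /GRing.add /= => E1 E2.
by congr pair; lia.
Qed.

Lemma mnorm_ltD (R : realType) (N : int * int -> R) (a b : vec) :
  monotone_norm N -> b <> (0, 0) -> (N (vec_int a) < N (vec_int (a + b)))%R.
Proof.
case: a b => [a1 a2] [b1 b2] hN b0.
rewrite /vec_int /=.
change (N (Posz a1, Posz a2) < N (Posz (a1 + b1)%N, Posz (a2 + b2)%N))%R.
have [b10|b10] := posnP b1.
  rewrite b10 addn0; apply: mnorm_lt2 => //.
  have : b2 <> 0 by move=> b20; apply: b0; rewrite b10 b20.
  by lia.
apply: (@lt_le_trans _ _ (N (Posz (a1 + b1)%N, Posz a2))).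
  by apply: mnorm_lt1 => //; lia.
have [->|b20] := posnP b2; first by rewrite addn0.
by apply/ltW/mnorm_lt2 => //; lia.
Qed.

(** [m * N (1, 0) = N (m, 0) <= N (m, n)], and likewise for [n]. *)
Lemma mnorm_bounded (R : realType) (N : int * int -> R) (r : R) :
  monotone_norm N ->
  exists B, forall m n : nat, (N (vec_int (m, n)) <= r)%R -> m <= B /\ n <= B.
Proof.
move=> hN.
have N0 : N (0, 0)%R = 0%R.
  by have := mnormZ hN (0, 0)%R 0; rewrite normr0 mulr0z mul0r.
(* The absolute value keeps the quotient nonnegative when [r] is negative, as [archi_boundP]
   requires. *)
have bd (e : R) (k : nat) : (0 < e)%R -> (k%:R * e <= r)%R -> k <= Num.bound (`|r| / e)%R.
  move=> e0 ker; rewrite -(ler_nat R).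
  apply: (@le_trans _ _ (`|r| / e)%R).
    by rewrite ler_pdivlMr //; apply: le_trans ker (ler_norm r).
  by apply/ltW/archi_boundP; rewrite divr_ge0 // ltW.
have e1 : (0 < N (Posz 1, Posz 0))%R by rewrite -[X in (X < _)%R]N0; exact: (mnorm_lt1 hN 0).
have e2 : (0 < N (Posz 0, Posz 1))%R by rewrite -[X in (X < _)%R]N0; exact: (mnorm_lt2 hN 0).
have vecM (m n k : nat) : ((Posz m, Posz n) *~ k = (Posz (m * k)%N, Posz (n * k)%N))%R.
  elim: k => [|k IHk]; first by rewrite !muln0.
  by rewrite intS mulrzDr IHk !mulnS.
exists (maxn (Num.bound (`|r| / N (Posz 1, Posz 0))%R)
             (Num.bound (`|r| / N (Posz 0, Posz 1))%R)).
move=> m n; rewrite /vec_int /= => Nr.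
rewrite !leq_max; split; apply/orP; [left|right]; apply: bd => //; apply: le_trans Nr.
- have := mnormZ hN (Posz 1, Posz 0) m.
  rewrite vecM mul1n mul0n /= => <-.
  by have [->|n0] := posnP n; last exact/ltW/(mnorm_lt2 hN).
- have := mnormZ hN (Posz 0, Posz 1) n.
  rewrite vecM mul1n mul0n /= => <-.
  by have [->|m0] := posnP m; last exact/ltW/(mnorm_lt1 hN).
Qed.

(** * Stages of the construction *)

Section Run.
Context {R : realType} {N : int * int -> R} (hN : monotone_norm N).
Context {S : nat -> set vec} (hS : forall n, ulam_step N (S n) (S n.+1)).
Context (S0 : ~ S 0 (0, 0)).

Lemma run_subset (j k : nat) : j <= k -> S j `<=` S k.
Proof.
elim: k => [|k IHk]; first by rewrite leqn0 => /eqP ->.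
rewrite leq_eqVlt => /predU1P [->//|/IHk sjk] v /sjk.
by case: (hS k) => [[w [_ _ ->]]|[_ ->]]; [right|].
Qed.

Lemma run_nonzero (k : nat) : ~ S k (0, 0).
Proof.
elim: k => // k IHk; case: (hS k) => [[w [[_ [a [b [_ _ ab abw _]]]] _ ->]]|[_ ->]] //.
by case=> // w0; apply: ab; apply: vec_sum0; rewrite abw -w0.
Qed.

(* A new vector creates only candidates of larger norm. *)
Lemma run_candidate_norm (r : R) (j k : nat) : j <= k ->
  (forall z, ulam_candidate (S j) z -> r <= N (vec_int z))%R ->
  (forall z, ulam_candidate (S k) z -> r <= N (vec_int z))%R.
Proof.
move=> jk rj; elim: k jk => [|k IHk]; first by rewrite leqn0 => /eqP <-.
rewrite leq_eqVlt => /predU1P [<-//|/IHk {}IHk] z [Sz uz].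
have sk := @run_subset k k.+1 (leqnSn k).
case: (hS k) => [[w [wc _ SE]]|[noc SE]]; last by apply: IHk; rewrite -SE.
case: (uz) => a [b [Sa Sb ab abz _]].
have nz c : S k.+1 c -> c <> (0, 0) by move=> Sc c0; apply: (@run_nonzero k.+1); rewrite -c0.
have wlt c : S k.+1 c -> (w + c)%R = z -> (r <= N (vec_int z))%R.
  by move=> /nz c0 <-; apply/ltW/(le_lt_trans (IHk _ wc))/mnorm_ltD.
move: (Sa) (Sb); rewrite SE => -[aw|Ska]; first by move=> _; apply: (wlt b); rewrite -?aw.
case=> [bw|Skb]; first by apply: (wlt a) => //; rewrite addrC -bw.
apply: IHk; split; first by move=> /sk.
exact: (unique_sum_subset sk Ska Skb ab abz uz).
Qed.

(** Whatever enters after stage [j] is then a candidate, hence of norm at least [r]: stage [j] is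
    final below [r]. *)
Lemma run_added_norm (r : R) (j k : nat) (v : vec) :
  (forall z, ulam_candidate (S j) z -> r <= N (vec_int z))%R ->
  S k v -> (N (vec_int v) < r)%R -> S j v.
Proof.
move=> rj Skv Nv; have [/run_subset|/ltnW jk] := leqP k j; first exact.
elim: k jk Skv => [|k IHk]; first by rewrite leqn0 => /eqP ->.
rewrite leq_eqVlt => /predU1P [->//|]; rewrite ltnS => jk.
case: (hS k) => [[w [wc _ ->]]|[_ ->]]; last exact: IHk.
case=> [vw|]; last exact: IHk.
have := run_candidate_norm jk rj wc.
by rewrite -vw leNgt Nv.
Qed.

(** When [w] enters with least norm, all its possible summands, being of smaller norm, are already
    present; no later representation can appear. *)
Lemma run_unique_sum (v : vec) :
  (\bigcup_n S n) v -> S 0 v \/ unique_sum (\bigcup_n S n) v.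
Proof.
case=> k _; elim: k => [|k IHk]; first by left.
case: (hS k) => [[w [wc wmin ->]]|[_ ->]] //.
case=> // ->; right; case: wc => _ [a [b [Sa Sb ab abw uab]]].
exists a, b; split=> //; [by exists k|by exists k|].
move=> c d [i _ Sc] [j _ Sd] cd cdw.
have nz n e : S n e -> e <> (0, 0) by move=> Se e0; apply: (@run_nonzero n); rewrite -e0.
apply: uab => //.
  apply: (run_added_norm wmin Sc); rewrite -cdw; apply: mnorm_ltD => //.
  exact: nz Sd.
apply: (run_added_norm wmin Sd); rewrite -cdw addrC; apply: mnorm_ltD => //.
exact: nz Sc.
Qed.

(** If [v] never entered, it would stay a candidate once its summands are present, so every later
    stage would add a new vector of norm at most that of [v]; only finitely many exist. *)
Lemma run_complete (v : vec) :
  unique_sum (\bigcup_n S n) v -> (\bigcup_n S n) v.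
Proof.
move=> uv; apply: contrapT => nUv; case: (uv) => a [b [[i _ Sa] [j _ Sb] ab abv _]].
pose k0 := maxn i j.
have cand k : k0 <= k -> ulam_candidate (S k) v.
  rewrite geq_max => /andP [ik jk]; split; first by move=> Sv; apply: nUv; exists k.
  apply: (unique_sum_subset (T := \bigcup_n S n) _ _ _ ab abv uv).
  - by move=> z Sz; exists k.
  - exact: run_subset ik _ Sa.
  - exact: run_subset jk _ Sb.
have [B bB] := mnorm_bounded (N (vec_int v)) hN.
pose box k := [set p : 'I_B.+1 * 'I_B.+1 | `[< S k (val p.1, val p.2) >]]%SET.
have grow k : k <= #|box (k0 + k)|.
  elim: k => // k IHk; apply: leq_ltn_trans IHk _; apply: proper_card.
  have := cand (k0 + k) (leq_addr _ _); rewrite addnS => vc.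
  case: (hS (k0 + k)) => [[[w1 w2] [[Sw _] wmin SE]]|[noc _]]; last by case: (noc v).
  have [w1B w2B] := bB _ _ (wmin _ vc).
  apply/properP; split.
    apply/fintype.subsetP => p; rewrite !finset.in_set => /asboolP Sp.
    by apply/asboolP; rewrite SE; right.
  exists (inord w1, inord w2); rewrite finset.in_set /= !inordK //.
    by apply/asboolP; rewrite SE; left.
  by apply/asboolP.
(* One stage more than the box has points. *)
have := grow (#|{: 'I_B.+1 * 'I_B.+1}|).+1.
by rewrite leqNgt ltnS max_card.
Qed.

End Run.

Theorem theorem6p1 (R : realType) (N : int * int -> R) (hN : monotone_norm N)
    (vs : seq vec)
    (hvs : forall v : vec, v \in vs -> v.1 <> 0%N /\ v.2 <> 0%N)
    (U : set vec)
    (hU : is_ulam_set N ((1, 0)%N :: (0, 1)%N :: vs) U)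
    (hnd : ulam_nondegenerate N ((1, 0)%N :: (0, 1)%N :: vs)) :
  exists w1 w2 : nat, forall m n : nat, U (m, n) ->
    (w1 <= m)%N -> (w2 <= n)%N ->
    m = w1 %[mod 2] /\ n = w2 %[mod 2].
Proof.
case: hU => S [S0E hS UE].
have S0P v : S 0%N v <-> [\/ v = (1, 0)%N, v = (0, 1)%N | v \in vs].
  rewrite S0E /= !inE; split=> [/or3P[/eqP ->|/eqP ->|vv]|[->|->|->]]; rewrite ?eqxx ?orbT //.
  - by constructor 1.
  - by constructor 2.
  - by constructor 3.
have S00 : ~ S 0%N (0, 0)%N by case/S0P => // /hvs [].
(* The sum of coordinates bounds each of them; adding 2 gives [1 < M] even for empty [vs]. *)
have UP : ulam_closed (\max_(v <- vs) (v.1 + v.2)).+2 (S 0%N) U.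
  split=> //.
  - by apply/S0P; constructor 1.
  - by apply/S0P; constructor 2.
  - by move=> n /S0P [//|[//]|/hvs[]].
  - by move=> n /S0P [[]//|//|/hvs[]].
  - move=> m n /S0P [[-> ->]//|[-> ->]//|mn].
    have : (m + n <= \max_(v <- vs) (v.1 + v.2))%N.
      exact: (leq_bigmax_seq (F := fun v : vec => (v.1 + v.2)%N) (m, n) mn isT).
    by lia.
  - move=> v; rewrite UE; split; first exact: (run_unique_sum hN hS S00).
    by case=> [Sv|]; [exists 0%N|exact: (run_complete hN hS)].
have [m0 [n0 parn]] := ulam_row_parity UP.
have [n1 [m1 parm]] := ulam_row_parity (ulam_closed_transpose UP).
(* Adding twice the other threshold passes both thresholds and keeps the parity of [m1] and [n0]. *)
exists (m1 + m0.*2)%N, (n0 + n1.*2)%N => m n Umn m1m n0n.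
have := parn m n Umn; have := parm n m Umn; lia.
Qed.
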